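(* Let $n\ge3$ and $\omega$ be integers with $\lfloor 3n/4\rfloor\le\omega\le n-1$, and let $\mathcal{P}(n,\omega)$ be the set of shift-equivalence classes of binary sequences with least period $n$ and nonlinear complexity $\omega$. Then $$|\mathcal{P}(n,\omega)|=\sum_{d=1}^{n-\omega-1}\sum_{e\mid d}\mu(e)\,2^{\,n-\omega-1-d+d/e}+\sum_{d=n-\omega}^{\lfloor n/2\rfloor}|N(n,d,\omega+d-n)|,$$ where $\mu$ is the Möbius function and the sets $N(n,d,t)$ are as defined in the context.
   Context: All sequences are binary (entries in $\mathbb{Z}_2$), $\overline{x}=x\oplus1$, and $x\bmod d$ is the least nonnegative residue. A finite sequence of length $m$ is periodic if it equals the concatenation of $m/e$ copies of a sequence of length $e$ for some proper divisor $e$ of $m$, and aperiodic otherwise. The nonlinear complexity of a sequence $\mathbf{u}=(u_0,u_1,\dots)$ is the least $L\ge0$ such that there exists $f:\mathbb{Z}_2^L\to\mathbb{Z}_2$ with $u_{i+L}=f(u_i,\dots,u_{i+L-1})$ for all $i$ (length of the shortest feedback shift register generating $\mathbf u$). Two periodic sequences are shift equivalent if one is a shift of the other. $\mu$ is the Möbius function: $\mu(1)=1$, $\mu(m)=(-1)^k$ if $m$ is a product of $k$ distinct primes, and $\mu(m)=0$ if $m$ is divisible by the square of a prime. For a positive integer $d$, $A(d)$ denotes the set of aperiodic binary sequences $\mathbf{s}_d=(s_0,\dots,s_{d-1})$ of length $d$. Define $N(n,d,0)=\{\mathbf{s}_d\in A(d): s_{(n-1)\bmod d}=s_{d-1}\}$,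 and for $t>0$, $N(n,d,t)=\{\mathbf{s}_d\in A(d): \overline{s_{(n-1)\bmod d}}=s_{d-1},\ s_{(n-i)\bmod d}=s_{(d-i)\bmod d}\ (2\le i\le t),\ s_{(n-t-1)\bmod d}=\overline{s_{(d-t-1)\bmod d}}\}$. *)

(* Defs.v *)
From mathcomp Require Import all_boot all_algebra.
From mathcomp Require Import boolp.
Set Implicit Arguments. Unset Strict Implicit. Unset Printing Implicit Defensive.
Import GRing.Theory Num.Theory.

Definition seq_of (n : nat) (w : n.-tuple bool) : nat -> bool :=
  fun i => nth false w (i %% n).

Definition is_period (u : nat -> bool) (p : nat) : Prop :=
  forall i, u (i + p) = u i.

Definition least_period (u : nat -> bool) (p : nat) : Prop :=
  0 < p /\ is_period u p /\ (forall q, 0 < q -> is_period u q -> p <= q).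

Definition fsr_generates (u : nat -> bool) (L : nat) : Prop :=
  exists f : seq bool -> bool,
    forall i, u (i + L) = f (mkseq (fun k => u (i + k)) L).

Definition nonlinear_complexity (u : nat -> bool) (L : nat) : Prop :=
  fsr_generates u L /\ (forall L', fsr_generates u L' -> L <= L').

Definition shift_equiv (u v : nat -> bool) : Prop :=
  (exists k, forall i, v i = u (i + k)) \/ (exists k, forall i, u i = v (i + k)).

(* Sequences with least period n and nonlinear complexity w, represented by
   their first n terms. *)
Definition Pseqs (n w : nat) : {set n.-tuple bool} :=
  [set x | `[< least_period (seq_of x) n /\ nonlinear_complexity (seq_of x) w >]].

Definition Pclasses (n w : nat) : {set {set n.-tuple bool}} :=
  [set [set y in Pseqs n w | `[< shift_equiv (seq_of x) (seq_of y) >]]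
  | x in Pseqs n w].

Definition squarefree (m : nat) : bool := all (fun p => logn p m == 1) (primes m).

Definition moebius (m : nat) : int :=
  (if m == 0 then 0 else if squarefree m then (-1) ^+ size (primes m) else 0)%R.

Definition periodic_word (s : seq bool) : bool :=
  [exists e : 'I_(size s), (0 < e) && (e %| size s) &&
     (s == flatten (nseq (size s %/ e) (take e s)))].

Definition Aset (d : nat) : {set d.-tuple bool} := [set s : d.-tuple bool | ~~ periodic_word s].

Definition md (x : int) (d : nat) : nat := `|(x %% d%:Z)%Z|%N.

Definition sN (d : nat) (s : d.-tuple bool) (x : int) : bool := nth false s (md x d).

Definition Nset (n d t : nat) : {set d.-tuple bool} :=
  [set s in Aset d |
    if t == 0 then sN s (n%:Z - 1) == sN s (d%:Z - 1)
    else [&& ~~ sN s (n%:Z - 1) == sN s (d%:Z - 1),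
             [forall i : 'I_t.+1, (2 <= i) ==>
                 (sN s (n%:Z - i%:Z) == sN s (d%:Z - i%:Z))] &
             sN s (n%:Z - t%:Z - 1) == ~~ sN s (d%:Z - t%:Z - 1)]].

(* Main.v *)
Require Import Defs.
From mathcomp Require Import all_boot all_algebra.
From mathcomp Require Import all_order zify boolp.
Import GRing.Theory Num.Theory.
Import Order.TTheory.
Local Open Scope ring_scope.

(** A sequence [U] of least period [n] has complexity [w] iff [w - 1] is the
length of its longest repeated factor, i.e. of the longest run of zeros of
[U x + U (x + d)] over [0 < d < n]; by symmetry one may take [d <= n / 2]. Such
a run makes [U] periodic of period [d] on a window of [w - 1 + d] places, with
an aperiodic period word (otherwise a smaller distance gives a longer run).
Conversely, as [w >= floor (3 n / 4)], two different such runs cannot coexist: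
if their windows overlap in [d + e - gcd d e] places this is the theorem of
Fine and Wilf, and otherwise it follows by comparing the supports of the two
sides of the identity [(1 + S^e)(1 + S^d) U = (1 + S^d)(1 + S^e) U] for the
shift [S]. So each class has one run, and rotating it to end just before the
last letter gives exactly one representative for one [d]. These representatives
are counted for each [d]: for [d < n - w] the window does not cover the period
and leaves [n - w - 1 - d] free letters; for [d >= n - w] the period word
determines everything and the compatibility conditions are those of
[Nset n d (w + d - n)]. *)

(** * Runs, local periods and the theorem of Fine and Wilf *)

Definition dif (U : int -> bool) (d x : int) : bool := U x (+) U (x + d).

(** Positions are integers, so that windows may start left of [0] and every shift can be undone. *)
Definition run (U : int -> bool) (d a L : int) : Prop :=
  forall x, a <= x < a + L -> U (x + d) = U x.

Definition period_on (U : int -> bool) (p a L : int) : Prop :=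
  forall x k, a <= x < a + L -> a <= x + k * p < a + L -> U (x + k * p) = U x.

Lemma period_on_step (U : int -> bool) (p a L : int) : 0 < p ->
  run U p a L -> period_on U p a (L + p).
Proof.
move=> p_gt0 stepU.
have up x (k : nat) : a <= x -> x + k%:Z * p < a + (L + p) ->
    U (x + k%:Z * p) = U x.
  elim: k => [|k IHk] xa xk; first by congr U; lia.
  have -> : x + k.+1%:Z * p = (x + k%:Z * p) + p by lia.
  have k0 : 0 <= k%:Z * p by nia.
  rewrite stepU ?IHk //; lia.
move=> x k; case: (lerP 0 k) => k0 xr yr.
  have := up x `|k|%N; rewrite gez0_abs //; apply; lia.
have := up (x + k * p) `|k|%N; rewrite ltz0_abs // => <-; first by congr U; lia.
  lia.
lia.
Qed.

Lemma period_on_sub (U : int -> bool) (p a b L K : int) :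
  period_on U p a L -> a <= b -> b + K <= a + L -> period_on U p b K.
Proof. by move=> perU ab bK x k ? ?; apply: perU; lia. Qed.

(** Any place of the long window can be moved by a multiple of [p] into the [p] places from [b] on,
    which the short window contains. As [g] divides [p], the move keeps residues modulo [g], so the
    short window decides. *)
Lemma period_on_refine (U : int -> bool) (p g a b L K : int) :
  0 < p -> (g %| p)%Z -> period_on U p a L -> period_on U g b K ->
  a <= b -> b + K <= a + L -> p <= K -> period_on U g a L.
Proof.
move=> p0 /dvdzP[h hp] perp perg ab bK pK.
pose r x := b + ((x - b) %% p)%Z.
have rE x : x = r x + ((x - b) %/ p)%Z * p by rewrite /r; have := divz_eq (x - b) p; lia.
have rb x : b <= r x < b + K.
  have := @modz_ge0 (x - b) p; rewrite gt_eqF // => /(_ isT).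
  have := ltz_pmod (x - b) p0; rewrite /r; lia.
have Ur x : a <= x < a + L -> U x = U (r x).
  move=> xr; rewrite {1}(rE x); apply: perp; first by have := rb x; lia.
  by rewrite -rE.
move=> x k xr yr; rewrite Ur // (Ur x) //.
set q1 := ((x - b) %/ p)%Z; set q2 := ((x + k * g - b) %/ p)%Z.
have -> : r (x + k * g) = r x + (k + q1 * h - q2 * h) * g.
  have := rE x; have := rE (x + k * g); rewrite -/q1 -/q2 hp; nia.
apply: perg; first exact: rb.
suff -> : r x + (k + q1 * h - q2 * h) * g = r (x + k * g) by exact: rb.
have := rE x; have := rE (x + k * g); rewrite -/q1 -/q2 hp; nia.
Qed.

(** Euclid's algorithm by subtraction. For [p < q], going [q] forward and [p] back gives the period
    [q - p] on the first [L - p] places, where the length bound holds again for [p] and [q - p];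
    [period_on_refine] carries the gcd back to the full window. *)
Lemma fine_wilf (U : int -> bool) (p q : nat) (a L : int) :
  (0 < p)%N -> (0 < q)%N -> p%:Z + q%:Z - (gcdn p q)%:Z <= L ->
  period_on U p%:Z a L -> period_on U q%:Z a L -> period_on U (gcdn p q)%:Z a L.
Proof.
have [s] := ubnP (p + q)%N; elim: s p q L => // s IHs p q L.
wlog pq : p q / (p <= q)%N.
  move=> W; case: (leqP p q) => [|/ltnW] pq; first exact: W.
  by move=> *; rewrite gcdnC; apply: W => //; rewrite ?(gcdnC q) //; lia.
move=> pqs p0 q0 lenL perp perq.
have [pqe|npq] := eqVneq p q; first by rewrite -pqe gcdnn.
have {npq pq}pq : (p < q)%N by rewrite ltn_neqAle npq.
have gE : gcdn p (q - p) = gcdn p q.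
  by rewrite -[in RHS](subnK (ltnW pq)) gcdnDr.
have g_dvdp := dvdn_gcdl p q.
have gp : (gcdn p q <= q - p)%N by rewrite -gE dvdn_leq ?dvdn_gcdr // subn_gt0.
apply: (@period_on_refine U p%:Z _ a a L (L - p%:Z)) => //; try lia.
rewrite -gE; apply: IHs; try lia.
- by apply: period_on_sub perp _ _; lia.
- have -> : L - p%:Z = (L - q%:Z) + (q - p)%N%:Z by lia.
  apply: period_on_step => [|x xr]; first lia.
  have <- : U (x + 1 * q%:Z) = U x by apply: perq; lia.
  have <- : U (x + (q - p)%N%:Z + 1 * p%:Z) = U (x + (q - p)%N%:Z) by apply: perp; lia.
  by congr U; lia.
Qed.

(** * Two long runs *)

Lemma dif_shift (U : int -> bool) (n d : int) :
  (forall x, U (x + n) = U x) -> forall x, dif U d (x + n) = dif U d x.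
Proof. by move=> Un x; rewrite /dif Un -addrA (addrC n) addrA Un. Qed.

Lemma dif_dif (U : int -> bool) (d e x : int) :
  dif U d x (+) dif U d (x + e) = dif U e x (+) dif U e (x + d).
Proof.
rewrite /dif -addrA (addrC e d) addrA.
by case: (U x); case: (U (x + d)); case: (U (x + e)); case: (U (x + d + e)).
Qed.

(* Write [A], [B] for the differences of [U] at distances [d], [e]; each is
   supported on an arc (from [p - m1] to [p], from [q - m2] to [q]) with both its
   endpoints in the support. Evaluating [A x (+) A (x + e) = B x (+) B (x + d)] ([dif_dif]) at
   the endpoints of one side and inside the long gap of the other side excludes
   everything except two families with [n = 4 * m2 - 3], which are finished by
   one or two further evaluations, and the case [n = 5]. *)
Lemma no_two_runs (U : int -> bool) (n d e m1 m2 p q : int) :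
  (forall x, U (x + n) = U x) -> 1 <= d -> d < e -> 2 * e < n ->
  1 <= m1 -> 4 * m1 <= n + 3 -> 1 <= m2 -> 4 * m2 <= n + 3 ->
  dif U d p -> dif U d (p - m1) ->
  (forall x, p < x < p + n - m1 -> dif U d x = false) ->
  dif U e q -> dif U e (q - m2) ->
  (forall x, q < x < q + n - m2 -> dif U e x = false) ->
  n - m2 + 1 - d <= p - q <= m1 + e - 1 -> False.
Proof.
move=> Un d1 de en m11 m1n m21 m2n Ap Apm A0 Bq Bqm B0 pq.
have Ush x y : (y = x + n \/ y = x \/ y = x - n) -> U y = U x.
  by move=> [->|[->|->]] //; rewrite -(Un (x - n)) subrK.
have {}A0 x : (p < x < p + n - m1) \/ (p < x + n < p + n - m1) ->
    dif U d x = false.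
  by case=> [|xr]; [exact: A0|rewrite -(@dif_shift _ n) // A0].
have {}B0 x : (q < x < q + n - m2) \/ (q < x + n < q + n - m2) \/
     (q < x - n < q + n - m2) -> dif U e x = false.
  case=> [|[]] xr; [exact: B0|by rewrite -(@dif_shift _ n) // B0|].
  by rewrite -[x](subrK n) (@dif_shift _ n) // B0.
have EG x : q < x < q + n - m2 - d -> dif U d x = dif U d (x + e).
  move=> xr; have := dif_dif U d e x; rewrite !B0 /=; [|lia..].
  by case: (dif U d x); case: (dif U d (x + e)).
have EH x : p < x < p + n - m1 - e -> dif U e x = dif U e (x + d).
  move=> xr; have := dif_dif U d e x; rewrite !A0 /=; [|lia..].
  by case: (dif U e x); case: (dif U e (x + d)).
have [em1|em1] := ltrP m1 e.
  have Ge : ~ (q < p - e < q + n - m2 - d).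
    by move=> /EG; rewrite subrK Ap A0 //; lia.
  have Gm : ~ (q < p - m1 < q + n - m2 - d).
    by move=> /EG; rewrite Apm A0 //; lia.
  have [dm2|dm2] := ltrP m2 d.
    have Hd : ~ (p < q + n - d < p + n - m1 - e).
      move=> /EH; rewrite subrK (@dif_shift _ n) // Bq B0 //; lia.
    have Hm : ~ (p < q + n - m2 < p + n - m1 - e).
      move=> /EH; rewrite addrAC (@dif_shift _ n) // Bqm B0 //; lia.
    lia.
  have [m1E [dE [eE qE]]] : m1 = 1 /\ d = m2 /\ e = 2 * m2 - 2 /\ q = p - 2 * m2 + 2.
    lia.
  have nE : n = 4 * m2 - 3 by lia.
  (* At this place the only other nonzero term of [dif_dif] is [dif U d (p - m1)], so [dif U e] must
     hold. A step of [d] to the left, just outside the arc of [dif U e], it is then the only nonzero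
     term, a contradiction. *)
  have B1 : dif U e (p - 2 * m2 + 1).
    have := dif_dif U d e (p - 2 * m2 + 1).
    have -> : p - 2 * m2 + 1 + e = p - m1 by lia.
    by rewrite Apm (A0 (p - 2 * m2 + 1)) ?(B0 (_ + d)) ?addbF //; lia.
  have := dif_dif U d e (p - 3 * m2 + 1).
  have -> : p - 3 * m2 + 1 + d = p - 2 * m2 + 1 by lia.
  by rewrite B1 !A0 ?B0 //; lia.
have [m1E [m2E [dE [eE qE]]]] : m1 = m2 /\ m1 = e /\ d = m1 - 1 /\ n = 4 * m1 - 3 /\ q = p - 2 * m1 + 1.
  lia.
have [m3|m3] := ltrP 2 m1.
  have Am : dif U d (p - m1 + 1) = false.
    by rewrite EG ?A0 //; lia.
  have := dif_dif U d e q.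
  have -> : q + e = p - m1 + 1 by lia.
  by rewrite Am Bq A0 ?B0 //; lia.
(* Now [n = 5], [d = 1], [e = 2] and [p = q + 3]: every value involved is one of the five from [q]
   to [q + 4], and all cases are tried. *)
have m2' : m1 = 2 by lia.
have := B0 (q + 1); have := B0 (q + 2); move: Ap Apm Bq Bqm.
have := A0 (p + 1); have := A0 (p + 2); rewrite /dif.
have Uq k x : x = q + k -> U x = U (q + k) by move=> ->.
have Uq5 k x : x = q + k + n -> U x = U (q + k) by move=> ->; exact: Un.
rewrite (Uq 3 p) ?(Uq 4 (p + d)) ?(Uq 1 (p - m1)) ?(Uq 2 (p - m1 + d)); [|lia..].
rewrite (Uq 0 q) ?(Uq 2 (q + e)) ?(Ush (q + 3) (q - m2)) ?(Uq 0 (q - m2 + e)); [|lia..].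
rewrite (Uq 4 (p + 1)) ?(Ush (q + 0) (p + 1 + d)) ?(Ush (q + 0) (p + 2)) ?(Uq5 1 (p + 2 + d)); [|lia..].
rewrite ?(Uq 3 (q + 1 + e)) ?(Uq 4 (q + 2 + e)); [|lia..].
move=> H1 H2 H3 H4 H5 H6 H7 H8.
have {H1}H1 := H1 ltac:(lia). have {H2}H2 := H2 ltac:(lia).
have {H7}H7 := H7 ltac:(lia). have {H8}H8 := H8 ltac:(lia).
move: H1 H2 H3 H4 H5 H6 H7 H8.
by case: (U (q + 0)); case: (U (q + 1)); case: (U (q + 2)); case: (U (q + 3)); case: (U (q + 4)).
Qed.

Definition bounded_run (U : int -> bool) (d a L : int) : Prop :=
  [/\ run U d a L, dif U d (a - 1) & dif U d (a + L)].

Definition primitive_run (U : int -> bool) (d : nat) (a L : int) : Prop :=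
  forall g : nat, (g %| d)%N -> period_on U g%:Z a (L + d%:Z) -> g = d.

Lemma periodic_mul (U : int -> bool) (n : int) :
  (forall x, U (x + n) = U x) -> forall k x, U (x + k * n) = U x.
Proof.
move=> Un; have up (k : nat) x : U (x + k%:Z * n) = U x.
  elim: k x => [|k IHk] x; first by congr U; lia.
  by rewrite -[RHS]IHk -[RHS]Un; congr U; lia.
move=> k x; have [k0|k0] := lerP 0 k; first by rewrite -(gez0_abs k0) up.
by rewrite -[LHS](up `|k|%N) ltz0_abs //; congr U; lia.
Qed.

Lemma period_on_shift (U : int -> bool) (n k p a L : int) :
  (forall x, U (x + n) = U x) ->
  period_on U p (a + k * n) L -> period_on U p a L.
Proof.
move=> /periodic_mul Un perp x h xr yr.
rewrite -(Un k x) -(Un k (x + _)) addrAC; apply: perp; lia.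
Qed.

Lemma bounded_run_shift (U : int -> bool) (n k d a L : int) :
  (forall x, U (x + n) = U x) ->
  bounded_run U d a L -> bounded_run U d (a + k * n) L.
Proof.
move=> /periodic_mul Un [run aU LU].
have Dn x y : x = y + k * n -> dif U d x = dif U d y.
  by move=> ->; rewrite /dif addrAC !Un.
split=> [x xr||].
- rewrite -[RHS](Un (- k)) -[LHS](Un (- k)) addrAC run //; lia.
- by rewrite (Dn _ (a - 1)) //; lia.
- by rewrite (Dn _ (a + L)) //; lia.
Qed.

Lemma primitive_run_shift (U : int -> bool) (n k : int) (d : nat) (a L : int) :
  (forall x, U (x + n) = U x) ->
  primitive_run U d a L -> primitive_run U d (a + k * n) L.
Proof. by move=> Un prim g gd /(period_on_shift _ _ _ _ _ _ Un); apply: prim. Qed.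

(* A run at distance [n / 2] could be continued by its own shift by [n / 2]. *)
Lemma bounded_run_lt_half (U : int -> bool) (n d a L : int) :
  (forall x, U (x + n) = U x) -> 3 <= n -> 3 * n <= 4 * L + 7 ->
  2 * d <= n -> bounded_run U d a L -> 2 * d < n.
Proof.
move=> Un n3 nL dn [run aU _].
suff : 2 * d <> n by lia.
move=> n2d; move: aU; rewrite /dif -(run (a - 1 + d)); last by lia.
by rewrite (_ : a - 1 + d + d = a - 1 + n) ?Un ?addbb //; lia.
Qed.

(* Two long runs at different distances [d < e] either overlap enough for
   [fine_wilf], which contradicts primitivity, or fall under [no_two_runs]. *)
Lemma run_distance_unique (U : int -> bool) (n d e : nat) (a c L M : int) :
  (forall x, U (x + n%:Z) = U x) -> (0 < d)%N -> (2 * d <= n)%N -> (2 * e <= n)%N ->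
  3 <= n%:Z -> L <= n%:Z - 2 -> 3 * n%:Z <= 4 * L + 7 ->
  M <= n%:Z - 2 -> 3 * n%:Z <= 4 * M + 7 ->
  bounded_run U d%:Z a L -> bounded_run U e%:Z c M ->
  primitive_run U d a L -> primitive_run U e c M -> ~ (d < e)%N.
Proof.
move=> Un d0 dn en n3 Ln nL Mn nM.
wlog ac : a / c <= a < c + n%:Z.
  move=> W runa runc prima primc.
  have aE : c + ((a - c) %% n%:Z)%Z = a + (- ((a - c) %/ n%:Z)%Z) * n%:Z.
    have := divz_eq (a - c) n%:Z; lia.
  have n0 : n%:Z != 0 by lia.
  apply: (W (a + (- ((a - c) %/ n%:Z)%Z) * n%:Z)) => //.
  - rewrite -aE; have := modz_ge0 (a - c) n0.
    by have := @ltz_pmod (a - c) n%:Z; lia.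
  - exact: bounded_run_shift.
  - exact: primitive_run_shift.
move=> runa runc prima primc de.
have en' : 2 * e%:Z < n%:Z.
  by apply: (@bounded_run_lt_half U n%:Z e%:Z c M) runc => //; lia.
have [sa oa1 oa2] := runa; have [sc oc1 oc2] := runc.
have Xd : period_on U d%:Z a (L + d%:Z) by apply: period_on_step => //; lia.
have Ye : period_on U e%:Z c (M + e%:Z) by apply: period_on_step => //; lia.
have g0 : (0 < gcdn d e)%N by rewrite gcdn_gt0 d0.
(* If the windows, up to [j] periods of [U], share [d + e - 1] places, the gcd is a period of both,
   and primitivity of both runs makes it equal to [d] and to [e]. *)
have no_overlap b K j : d%:Z + e%:Z - 1 <= K -> a <= b + j * n%:Z ->
    b + j * n%:Z + K <= a + (L + d%:Z) -> c <= b -> b + K <= c + (M + e%:Z) -> False.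
  move=> lenK ab bK cb bK'.
  have perg : period_on U (gcdn d e)%:Z b K.
    apply: fine_wilf; try lia.
      by apply: (@period_on_shift _ n%:Z j) => //; apply: period_on_sub Xd ab bK.
    by apply: period_on_sub Ye cb bK'.
  have gd := dvdn_gcdl d e; have ge := dvdn_gcdr d e.
  have gdE : gcdn d e = d.
    apply: prima => //.
    apply: (@period_on_refine U d%:Z (gcdn d e)%:Z a (b + j * n%:Z) _ K) => //; try lia.
    apply: (@period_on_shift _ n%:Z (- j)) => //.
    by rewrite mulNr addrK.
  have geE : gcdn d e = e.
    apply: primc => //.
    by apply: (@period_on_refine U e%:Z (gcdn d e)%:Z c b _ K) => //; lia.
  lia.
(* With [p = a - 1], the place [p - m1] is [a + L - n], the right end of the run one period earlier;
   so the differences are supported on an arc from [p - m1] to [p]. The two cases below are the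
   overlaps at [a] and at [c + n]; what remains is the position hypothesis of [no_two_runs]. *)
pose m1 := n%:Z - 1 - L; pose m2 := n%:Z - 1 - M.
have [h1|h1] := lerP (a - c) (n%:Z - m2 - d%:Z).
  by apply: (no_overlap a (d%:Z + e%:Z - 1) 0); rewrite /m2 in h1; lia.
have [h2|h2] := lerP (m1 + e%:Z) (a - c).
  by apply: (no_overlap c (d%:Z + e%:Z - 1) 1); rewrite /m1 in h2; lia.
rewrite /m1 /m2 in h1 h2.
have Dn f x y : x + n%:Z = y -> dif U f y -> dif U f x.
  by move=> <-; rewrite dif_shift.
apply: (@no_two_runs U n%:Z d%:Z e%:Z m1 m2 (a - 1) (c - 1)); rewrite /m1 /m2 //; try lia.
- by apply: Dn oa2; lia.
- by move=> x xr; rewrite /dif sa ?addbb //; lia.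
- by apply: Dn oc2; lia.
- by move=> x xr; rewrite /dif sc ?addbb //; lia.
Qed.

(** For [L = w - 1] the bound [3 * n <= 4 * L + 7] says that the floor of [3 * n / 4] is at most
    [w]. Once the distances agree, only the place of the run is left to compare. *)
Lemma run_unique (U : int -> bool) (n d e : nat) (a c L M : int) :
  (forall x, U (x + n%:Z) = U x) -> (0 < d)%N -> (2 * d <= n)%N ->
  (0 < e)%N -> (2 * e <= n)%N ->
  3 <= n%:Z -> L <= n%:Z - 2 -> 3 * n%:Z <= 4 * L + 7 ->
  M <= n%:Z - 2 -> 3 * n%:Z <= 4 * M + 7 ->
  bounded_run U d%:Z a L -> bounded_run U e%:Z c M ->
  primitive_run U d a L -> primitive_run U e c M ->
  [/\ d = e, L = M & exists k, a = c + k * n%:Z].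
Proof.
move=> Un d0 dn e0 en n3 Ln nL Mn nM runa runc prima primc.
have deE : d = e.
  have := @run_distance_unique U n d e a c L M Un d0 dn en n3 Ln nL Mn nM runa runc prima primc.
  have := @run_distance_unique U n e d c a M L Un e0 en dn n3 Mn nM Ln nL runc runa primc prima.
  lia.
subst e.
pose k := ((a - c) %/ n%:Z)%Z; pose c' := c + k * n%:Z.
have c'a : c' <= a < c' + n%:Z.
  have := divz_eq (a - c) n%:Z; have := @ltz_pmod (a - c) n%:Z.
  have := @modz_ge0 (a - c) n%:Z; rewrite /c' /k; lia.
have [sa oa1 oa2] := runa.
have [sc oc1 oc2] := @bounded_run_shift U n%:Z k _ _ _ Un runc.
have A0 x : a <= x < a + L -> dif U d%:Z x = false by move=> xr; rewrite /dif sa ?addbb.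
have C0 x : c' <= x < c' + M -> dif U d%:Z x = false by move=> xr; rewrite /dif sc ?addbb.
have Dn x : dif U d%:Z (x + n%:Z) = dif U d%:Z x by rewrite dif_shift.
(* With different starts, the nonzero differences at their ends would keep the two runs disjoint,
   and two runs of this length do not fit into one period. *)
have acE : a = c'.
  have [ac|ac] := eqVneq a c' => //.
  have h1 : ~ (c' <= a - 1 < c' + M) by move=> /C0; rewrite oa1.
  have h2 : ~ (a <= c' - 1 + n%:Z < a + L) by move=> /A0; rewrite Dn oc1.
  lia.
split=> //; last by exists k.
have h1 : ~ (a <= c' + M < a + L) by move=> /A0; rewrite oc2.
have h2 : ~ (c' <= a + L < c' + M) by move=> /C0; rewrite oa2.
lia.
Qed.

(** * Existence of a longest run *)

(* Following the points [c - 1 + k * d] through [d]-steps, a full cycle returns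
   to its start without ever using the pair at [c - 1]. *)
Lemma run_pred_full (U : int -> bool) (n d : nat) (c : int) :
  (forall x, U (x + n%:Z) = U x) -> (0 < n)%N ->
  run U d%:Z c (n%:Z - 1) -> U (c - 1 + d%:Z) = U (c - 1).
Proof.
move=> Un n0 rund; apply/eqP; apply: contraT => neq.
have Un' := @periodic_mul U n%:Z Un.
have walk (k : nat) : U (c - 1 + d%:Z + k%:Z * d%:Z) = U (c - 1 + d%:Z).
  elim: k => [|k IHk]; first by congr U; lia.
  set y := c - 1 + d%:Z + k%:Z * d%:Z in IHk *.
  have -> : c - 1 + d%:Z + k.+1%:Z * d%:Z = y + d%:Z by rewrite /y; lia.
  pose q := ((y - (c - 1)) %/ n%:Z)%Z; pose r := ((y - (c - 1)) %% n%:Z)%Z.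
  have yE : y = c - 1 + r + q * n%:Z by have := divz_eq (y - (c - 1)) n%:Z; rewrite -/q -/r; lia.
  have r0 : 0 <= r by apply: modz_ge0; lia.
  have rn : r < n%:Z by have := @ltz_pmod (y - (c - 1)) n%:Z; rewrite -/r; lia.
  have Uy : U (c - 1 + r) = U y by rewrite yE Un'.
  have [rz|rz] := eqVneq r 0.
    by rewrite rz addr0 IHk in Uy; rewrite Uy eqxx in neq.
  rewrite -IHk -Uy -(rund (c - 1 + r)); last by lia.
  by rewrite -[RHS](Un' q); congr U; lia.
have := walk n.-1; have := Un' d%:Z (c - 1).
have -> : c - 1 + d%:Z * n%:Z = c - 1 + d%:Z + n.-1%:Z * d%:Z by nia.
by move=> -> E; rewrite E eqxx in neq.
Qed.

Lemma run_full (U : int -> bool) (n : nat) (d c : int) :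
  (forall x, U (x + n%:Z) = U x) -> (0 < n)%N -> run U d c n%:Z ->
  forall x, U (x + d) = U x.
Proof.
move=> Un n0 rund x; have Un' := @periodic_mul U n%:Z Un.
pose q := ((x - c) %/ n%:Z)%Z; pose r := ((x - c) %% n%:Z)%Z.
have xE : x = c + r + q * n%:Z by have := divz_eq (x - c) n%:Z; rewrite -/q -/r; lia.
have r0 : 0 <= r by apply: modz_ge0; lia.
have rn : r < n%:Z by have := @ltz_pmod (x - c) n%:Z; rewrite -/r; lia.
by rewrite xE addrAC !Un' rund //; lia.
Qed.

(** By periodicity a pair at distance [d], read from its other end, is a pair at distance
    [n - d]. *)
Lemma run_half (U : int -> bool) (n d : nat) (c L : int) :
  (forall x, U (x + n%:Z) = U x) -> (0 < d < n)%N -> run U d%:Z c L ->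
  exists e c', [/\ (0 < e)%N, (2 * e <= n)%N & run U e%:Z c' L].
Proof.
move=> Un dn rund; have [h|h] := leqP (2 * d) n; first by exists d, c; split=> //; lia.
exists (n - d)%N, (c + d%:Z); split; [lia..|].
move=> x xr; have <- : U (x - d%:Z + d%:Z) = U x by rewrite subrK.
rewrite rund; last lia.
by rewrite -[RHS]Un; congr U; lia.
Qed.

(** Take [L] maximal over all distances up to [n / 2]. Then the run cannot be prolonged at either
    end, and a period [g < e] of its window would give a run of length [L + e - g]. A run of length
    [n - 1] would close up to a full period by [run_pred_full]. *)
Lemma longest_run (U : int -> bool) (n : nat) (d L0 : nat) (c : int) :
  (forall x, U (x + n%:Z) = U x) ->
  (forall f : nat, (0 < f < n)%N -> ~ forall x, U (x + f%:Z) = U x) ->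
  (0 < d < n)%N -> run U d%:Z c L0%:Z ->
  exists e c' (L : nat), [/\ (0 < e)%N && (2 * e <= n)%N, (L0 <= L)%N && (L + 2 <= n)%N,
    bounded_run U e%:Z c' L%:Z & primitive_run U e c' L%:Z].
Proof.
move=> Un Uleast dn rund.
have n0 : (0 < n)%N by lia.
pose P (L : nat) := `[< exists (e : nat) c', [/\ (0 < e)%N, (2 * e <= n)%N & run U e%:Z c' L%:Z] >].
have exP : exists L, P L.
  by exists L0; apply/asboolP; apply: run_half rund.
have bP L : P L -> (L <= n)%N.
  move=> /asboolP[e [c' [e0 en rune]]]; rewrite leqNgt; apply/negP => nL.
  have : (0 < e < n)%N by lia.
  by move=> /Uleast[]; apply: (@run_full U n e%:Z c') => // x xr; apply: rune; lia.
case: (ex_maxnP exP bP) => L /asboolP[e [c' [e0 en rune]]] maxL.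
have longer f c2 K : (0 < f)%N -> (2 * f <= n)%N -> run U f%:Z c2 K%:Z -> (K <= L)%N.
  by move=> f0 fn runf; apply: maxL; apply/asboolP; exists f, c2.
have L1 : (L + 1 < n)%N.
  rewrite ltnNge; apply/negP => nL.
  have : (0 < e < n)%N by lia.
  move=> /Uleast[]; apply: (@run_full U n e%:Z (c' - 1)) => // x xr.
  have [->|xc] := eqVneq x (c' - 1); last by apply: rune; lia.
  by apply: (@run_pred_full U n) => // y yr; apply: rune; lia.
exists e, c', L; split.
- by rewrite e0 en.
- have [e1 [c1 [e10 e1n run1]]] := @run_half U n d c L0%:Z Un dn rund.
  by have := longer _ _ _ e10 e1n run1; lia.
- split=> //; apply: contraT; rewrite /dif negb_add => /eqP E.
    have : run U e%:Z (c' - 1) L.+1%:Z.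
      move=> x xr; have [->|xc] := eqVneq x (c' - 1); first by rewrite -E.
      by apply: rune; lia.
    by move=> /(longer _ _ _ e0 en); rewrite ltnn.
  have : run U e%:Z c' L.+1%:Z.
    move=> x xr; have [->|xc] := eqVneq x (c' + L%:Z); first by rewrite -E.
    by apply: rune; lia.
  by move=> /(longer _ _ _ e0 en); rewrite ltnn.
- move=> g ge perg; have ge' : (g <= e)%N by apply: dvdn_leq.
  have g0 : (0 < g)%N by apply: dvdn_gt0 ge.
  have : run U g%:Z c' (L + e - g)%N%:Z.
    by move=> x xr; rewrite -{1}(mul1r g%:Z); apply: perg; lia.
  by move=> /(longer _ _ _ g0); lia.
Qed.

(** A smaller period yields a period [p] with [2 * p <= n], short enough for Fine and Wilf against
    [d] on the window of the run. Primitivity gives that [d] divides [p], so [d] becomes a period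
    beyond the window too, against the difference at [a + L]. *)
Lemma primitive_run_least_period (U : int -> bool) (n d f : nat) (a L : int) :
  (forall x, U (x + n%:Z) = U x) -> 3 <= n%:Z -> (0 < d)%N -> 3 * n%:Z <= 4 * L + 7 ->
  bounded_run U d%:Z a L -> primitive_run U d a L ->
  (0 < f < n)%N -> ~ forall x, U (x + f%:Z) = U x.
Proof.
move=> Un n3 d0 nL [rund _ aL] prim fn Uf.
have glob p K : (forall x, U (x + p) = U x) -> period_on U p a K.
  by move=> /periodic_mul Up x k _ _; apply: Up.
(* [K] is long enough for Fine and Wilf with [f] and [n], and for the window to contain
   [a + L + d]. *)
pose p := gcdn f n; pose K : int := f%:Z + n%:Z + L + d%:Z + 1.
have p0 : (0 < p)%N by rewrite gcdn_gt0; lia.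
have perp : period_on U p%:Z a K.
  by apply: fine_wilf; rewrite -/p /K; try lia; apply: glob.
have /dvdnP[h hn] := dvdn_gcdr f n.
have pf : (p <= f)%N by apply: dvdn_leq; [lia|exact: dvdn_gcdl].
have pn : (2 * p <= n)%N.
  rewrite -/p in hn; rewrite [leqRHS]hn leq_mul2r; apply/orP; right.
  by case: h hn => [|[|h]] //; lia.
have g0 : (0 < gcdn p d)%N by rewrite gcdn_gt0 p0.
have perd : period_on U d%:Z a (L + d%:Z) by apply: period_on_step => //; lia.
have perg : period_on U (gcdn p d)%:Z a (L + d%:Z).
  apply: fine_wilf => //; first by lia.
  by apply: period_on_sub perp _ _; rewrite /K; lia.
have gd := prim _ (dvdn_gcdr p d) perg.
have perK : period_on U d%:Z a K.
  apply: (@period_on_refine U p%:Z d%:Z a a K (L + d%:Z)) => //; rewrite /K; try lia.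
  by rewrite -gd; exact: dvdn_gcdl.
have := perK (a + L) 1; rewrite mul1r /K => E; move: aL.
by rewrite /dif E ?addbb //; lia.
Qed.

(** * Complexity and runs *)

Lemma sN_periodic (n : nat) (s : n.-tuple bool) (x : int) : sN s (x + n%:Z) = sN s x.
Proof. by rewrite /sN /md modzDr. Qed.

Lemma sN_periodic_mul (n : nat) (s : n.-tuple bool) (k x : int) :
  sN s (x + k * n%:Z) = sN s x.
Proof. by apply: (@periodic_mul (sN s) n%:Z) => y; apply: sN_periodic. Qed.

Lemma sN_nat (n : nat) (s : n.-tuple bool) (i : nat) : sN s i%:Z = seq_of s i.
Proof. by rewrite /sN /md modz_nat absz_nat. Qed.

Lemma sN_nth (n : nat) (s : n.-tuple bool) (i : nat) :
  (i < n)%N -> sN s i%:Z = nth false s i.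
Proof. by move=> ltin; rewrite sN_nat /seq_of modn_small. Qed.

Lemma int_mod_repr (n : nat) (c : int) : (0 < n)%N ->
  exists i : nat, (i < n)%N /\ exists q, c = i%:Z + q * n%:Z.
Proof.
move=> n0; exists `|(c %% n%:Z)%Z|%N.
have c0 : 0 <= (c %% n%:Z)%Z by apply: modz_ge0; lia.
have := @ltz_pmod c n%:Z; have := divz_eq c n%:Z.
by split; [|exists (c %/ n%:Z)%Z]; lia.
Qed.

Lemma fsr_generatesP (u : nat -> bool) (L : nat) :
  fsr_generates u L <->
  forall i j, (forall k, (k < L)%N -> u (i + k)%N = u (j + k)%N) ->
    u (i + L)%N = u (j + L)%N.
Proof.
split=> [[f fu] i j eqij|det].
  rewrite !fu; congr f; apply: (@eq_from_nth _ false); rewrite !size_mkseq // => k kL.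
  by rewrite !nth_mkseq ?eqij.
exists (fun w => `[< exists j, mkseq (fun k => u (j + k)%N) L = w /\ u (j + L)%N >]) => i.
apply/idP/asboolP => [ui|[j [eqij uj]]]; first by exists i.
rewrite (det i j) // => k kL.
by move/(congr1 (fun s => nth false s k)): eqij; rewrite !nth_mkseq.
Qed.

Lemma fsr_generates_leq (u : nat -> bool) (L M : nat) :
  (L <= M)%N -> fsr_generates u L -> fsr_generates u M.
Proof.
move=> LM /fsr_generatesP det; apply/fsr_generatesP => i j eqij.
have /det : forall k, (k < L)%N -> u (i + (M - L) + k)%N = u (j + (M - L) + k)%N.
  by move=> k kL; rewrite -!addnA; apply: eqij; lia.
by rewrite -!addnA subnK.
Qed.

(** Two equal blocks of length [L] at distance [d] are a run of length [L]. A feedback function of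
    that length prolongs the run forever, making [d] a period; if there is none, two equal blocks
    have different successors. *)
Lemma PseqsP (n w : nat) (x : n.-tuple bool) : (0 < n)%N -> (0 < w)%N ->
  reflect ((forall (d : nat) c, (0 < d < n)%N -> ~ run (sN x) d%:Z c w%:Z) /\
    exists (d : nat) c, (0 < d < n)%N /\ run (sN x) d%:Z c w.-1%:Z)
  (x \in Pseqs n w).
Proof.
move=> n0 w0; rewrite inE.
have Un := @sN_periodic n x; have Un' := @sN_periodic_mul n x.
have uE i : seq_of x i = sN x i%:Z by rewrite sN_nat.
have run_cat d c L : run (sN x) d c L%:Z -> sN x (c + L%:Z + d) = sN x (c + L%:Z) ->
    run (sN x) d c L.+1%:Z.
  move=> rund E y yr; have [->|yc] := eqVneq y (c + L%:Z) => //.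
  by apply: rund; lia.
apply: (iffP (asboolP _)) => [[[_ [_ minn]] [gen ming]]|[noW [d [c [dn rund]]]]].
  split=> [d c dn rund|].
    suff perd : is_period (seq_of x) d.
      by have d0 : (0 < d)%N; [lia|have := minn d d0 perd; lia].
    have [i [_ [q cE]]] := @int_mod_repr n c n0.
    have runs (k : nat) : run (sN x) d%:Z c (w + k)%N%:Z.
      elim: k => [|k IHk]; first by rewrite addn0.
      rewrite addnS; apply: run_cat => //.
      have /fsr_generatesP := gen => /(_ (i + k + d)%N (i + k)%N).
      have E a : sN x (i + a)%N%:Z = sN x (c + a%:Z).
        by rewrite -(Un' q) cE; congr (sN x _); lia.
      rewrite !uE => H.
      have -> : sN x (c + (w + k)%N%:Z + d%:Z) = sN x (i + k + d + w)%N%:Z.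
        by rewrite -!addnA E; congr (sN x _); lia.
      have -> : sN x (c + (w + k)%N%:Z) = sN x (i + k + w)%N%:Z.
        by rewrite -!addnA E; congr (sN x _); lia.
      apply: H => l lw; rewrite !uE -!addnA !E.
      by rewrite -(IHk (c + (k + l)%N%:Z)); [congr (sN x _); lia|lia].
    by move=> j; rewrite !uE PoszD; apply: (@run_full _ n d%:Z c) => //;
       move=> y yr; apply: (runs n); lia.
  have : ~ fsr_generates (seq_of x) w.-1 by move=> /ming; lia.
  move=> /fsr_generatesP/existsNP[i /existsNP[j]].
  rewrite not_implyE => -[eqij neq].
  wlog ij : i j eqij neq / (i <= j)%N.
    move=> W; have [|/ltnW] := leqP i j; first exact: W.
    by apply: W => [k kw|E]; [rewrite eqij|apply: neq].
  have [d [dn [q jE]]] := @int_mod_repr n (j - i)%N%:Z n0.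
  have jE' a : sN x (j + a)%N%:Z = sN x (i%:Z + a%:Z + d%:Z).
    by rewrite -[RHS](Un' q); congr (sN x _); lia.
  exists d, i%:Z; split.
    rewrite dn andbT lt0n; apply/eqP => d0; apply: neq.
    by rewrite !uE jE' d0 addr0.
  move=> y yr; have -> : y = i%:Z + `|(y - i%:Z)|%N%:Z by lia.
  by rewrite -jE' -!uE -eqij; [rewrite uE PoszD|lia].
(* A period below [n] would give runs of every length, in particular [w]. *)
have least q : (0 < q)%N -> is_period (seq_of x) q -> (n <= q)%N.
  move=> q0 perq; rewrite leqNgt; apply/negP => qn.
  apply: (noW q 0); first by rewrite q0.
  move=> y yr; have -> : y = `|y|%N%:Z by lia.
  by rewrite -PoszD -!uE perq.
split.
  split=> //; split=> // i; by rewrite /seq_of modnDr.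
split.
  apply/fsr_generatesP => i j.
  wlog ij : i j / (i <= j)%N.
    move=> W; have [|/ltnW] := leqP i j; first exact: W.
    by move=> ji eqij; symmetry; apply: W => // k kw; rewrite eqij.
  have [f [fn [q jE]]] := @int_mod_repr n (j - i)%N%:Z n0.
  have jE' a : sN x (j + a)%N%:Z = sN x (i%:Z + a%:Z + f%:Z).
    by rewrite -[RHS](Un' q); congr (sN x _); lia.
  move=> eqij; rewrite !uE jE'.
  have [->|f0] := posnP f; first by rewrite addr0 PoszD.
  case: (noW f i%:Z) => [|y yr]; first by rewrite f0.
  have -> : y = i%:Z + `|(y - i%:Z)|%N%:Z by lia.
  by rewrite -jE' -!uE -eqij; [rewrite uE PoszD|lia].
move=> L genL; rewrite leqNgt; apply/negP => Lw.
have {}genL : fsr_generates (seq_of x) w.-1 by apply: fsr_generates_leq genL; lia.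
apply: (noW d c dn); rewrite -(prednK w0); apply: run_cat => //.
have [i [_ [q cE]]] := @int_mod_repr n c n0.
have E a : sN x (i + a)%N%:Z = sN x (c + a%:Z).
  by rewrite -(Un' q) cE; congr (sN x _); lia.
have /fsr_generatesP := genL => /(_ (i + d)%N i).
rewrite !uE -!addnA !E => H.
have -> : c + w.-1%:Z + d%:Z = c + (d + w.-1)%N%:Z by lia.
apply: H => k kw; rewrite !uE -!addnA !E -(rund (c + k%:Z)); last by lia.
by congr (sN x _); lia.
Qed.

(** * Anchored representatives of the shift classes *)

Lemma bounded_run_translate (U V : int -> bool) (k d a L : int) :
  (forall x, V x = U (x + k)) -> bounded_run V d a L -> bounded_run U d (a + k) L.
Proof.
move=> VU [rund aL La].
have DE x y : y = x + k -> dif U d y = dif V d x.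
  by move=> ->; rewrite /dif !VU addrAC.
split=> [x xr||]; last 2 first.
- by rewrite (DE (a - 1)) // addrAC.
- by rewrite (DE (a + L)) // addrAC.
have := rund (x - k); rewrite !VU addrAC !subrK; apply; lia.
Qed.

Lemma primitive_run_translate (U V : int -> bool) (k : int) (d : nat) (a L : int) :
  (forall x, V x = U (x + k)) -> primitive_run V d a L -> primitive_run U d (a + k) L.
Proof.
move=> VU prim g gd perg; apply: prim => // x h xr yr.
by rewrite !VU addrAC; apply: perg; lia.
Qed.

Lemma sN_inj (n : nat) (x y : n.-tuple bool) : (forall z, sN x z = sN y z) -> x = y.
Proof.
move=> E; apply: val_inj; apply: (@eq_from_nth _ false); rewrite !size_tuple // => i ltin.
by rewrite -!sN_nth.
Qed.

Lemma shift_equivP (n : nat) (x y : n.-tuple bool) : (0 < n)%N ->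
  shift_equiv (seq_of x) (seq_of y) <-> exists k : int, forall z, sN y z = sN x (z + k).
Proof.
move=> n0.
have lift (s t : n.-tuple bool) (k : int) : (forall i : nat, sN t i%:Z = sN s (i%:Z + k)) ->
    forall z, sN t z = sN s (z + k).
  move=> E z; have [i [_ [q ->]]] := @int_mod_repr n z n0.
  by rewrite addrAC !sN_periodic_mul.
split=> [[[k E]|[k E]]|[k E]].
- by exists k%:Z; apply: lift => i; rewrite -PoszD !sN_nat.
- exists (- k%:Z) => z; rewrite -{1}(subrK k%:Z z); symmetry.
  by apply: (lift y x) => i; rewrite -PoszD !sN_nat.
- left; have [i [_ [q kE]]] := @int_mod_repr n k n0.
  by exists i => j; rewrite -!sN_nat E kE addrA sN_periodic_mul.
Qed.

Definition shifted {n : nat} (x : n.-tuple bool) (k : int) : n.-tuple bool :=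
  [tuple sN x ((i : nat)%:Z + k) | i < n].

Lemma sN_shifted (n : nat) (x : n.-tuple bool) (k z : int) : (0 < n)%N ->
  sN (shifted x k) z = sN x (z + k).
Proof.
move=> n0; have [i [ltin [q ->]]] := @int_mod_repr n z n0.
rewrite addrAC !sN_periodic_mul sN_nth //.
by rewrite -[i]/(val (Ordinal ltin)) -tnth_nth tnth_mktuple.
Qed.

(* The words whose longest repeated factor sits at a fixed place: position
   [n - w - d], so that the run ends just before the last letter. *)
Definition anchored (n w d : nat) : {set n.-tuple bool} :=
  [set x | `[< bounded_run (sN x) d%:Z (n%:Z - w%:Z - d%:Z) w.-1%:Z /\
               primitive_run (sN x) d (n%:Z - w%:Z - d%:Z) w.-1%:Z >]].

(** A run of length [w] would lead to a longest run, bounded and primitive, of length at least [w];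
    by [run_unique] it would be the anchored one, of length [w - 1]. *)
Lemma anchored_Pseqs (n w d : nat) (x : n.-tuple bool) :
  (3 <= n)%N -> (3 * n %/ 4 <= w)%N -> (w <= n - 1)%N -> (0 < d)%N -> (2 * d <= n)%N ->
  x \in anchored n w d -> x \in Pseqs n w.
Proof.
move=> n3 nw wn d0 dn; rewrite inE => /asboolP[brund prim].
have Un := @sN_periodic n x.
have w0 : (0 < w)%N by lia.
apply/PseqsP; [lia|done|split].
  move=> f c fn runf.
  have least g : (0 < g < n)%N -> ~ forall z, sN x (z + g%:Z) = sN x z.
    by apply: (@primitive_run_least_period (sN x) n d g _ _ Un _ _ _ brund prim); lia.
  have [e [c' [L [en Lw brune prime]]]] := @longest_run (sN x) n f w c Un least fn runf.
  have : [/\ d = e, w.-1%:Z = L%:Z & exists k, n%:Z - w%:Z - d%:Z = c' + k * n%:Z].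
    by apply: (@run_unique (sN x)); first [exact: Un|exact: brund|exact: brune|exact: prim|exact: prime|lia].
  by case; lia.
exists d, (n%:Z - w%:Z - d%:Z); split; first by lia.
by case: brund.
Qed.

(** Both words have their run just before the last letter, so uniqueness forces the shift [k] to be
    a multiple of [n]. *)
Lemma anchored_shift (n w d e : nat) (k : int) (x y : n.-tuple bool) :
  (3 <= n)%N -> (3 * n %/ 4 <= w)%N -> (w <= n - 1)%N ->
  (0 < d)%N -> (2 * d <= n)%N -> (0 < e)%N -> (2 * e <= n)%N ->
  x \in anchored n w d -> y \in anchored n w e ->
  (forall z, sN y z = sN x (z + k)) -> d = e /\ x = y.
Proof.
move=> n3 nw wn d0 dn e0 en; rewrite !inE => /asboolP[brx primx] /asboolP[bry primy] yx.
have Un := @sN_periodic n x.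
have {}bry := bounded_run_translate _ _ _ _ _ _ yx bry.
have {}primy := primitive_run_translate _ _ _ _ _ _ yx primy.
have [de _ [q aE]] : [/\ d = e, w.-1%:Z = w.-1%:Z & exists q,
    n%:Z - w%:Z - d%:Z = n%:Z - w%:Z - e%:Z + k + q * n%:Z].
  by apply: (@run_unique (sN x)); first [exact: Un|exact: brx|exact: bry|exact: primx|exact: primy|lia].
split=> //; apply: sN_inj => z; rewrite yx.
by rewrite -[RHS](@sN_periodic_mul n x q); congr (sN x _); lia.
Qed.

Lemma Pseqs_anchored (n w : nat) (x : n.-tuple bool) :
  (3 <= n)%N -> (0 < w)%N -> x \in Pseqs n w ->
  exists (d : nat) (k : int), [/\ (0 < d)%N, (2 * d <= n)%N & shifted x k \in anchored n w d].
Proof.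
move=> n3 w0 /PseqsP-/(_ (ltnW (ltnW n3)) w0)[noW [f [c [fn runf]]]].
have Un := @sN_periodic n x.
have least g : (0 < g < n)%N -> ~ forall z, sN x (z + g%:Z) = sN x z.
  by move=> gn Ug; apply: (noW g 0 gn).
have [d [c' [L [/andP[d0 dn] Lw brund primd]]]] := @longest_run (sN x) n f w.-1 c Un least fn runf.
have LE : L = w.-1.
  have [Lw'|Lw'] := ltnP L w; first by lia.
  case: (noW d c'); first by lia.
  by case: brund => rund _ _ y yr; apply: rund; lia.
subst L; pose k := c' - (n%:Z - w%:Z - d%:Z).
exists d, k; split=> //; rewrite inE; apply/asboolP.
have E z : sN x z = sN (shifted x k) (z + - k).
  by rewrite sN_shifted ?subrK //; lia.
have aE : n%:Z - w%:Z - d%:Z = c' + - k by rewrite /k; lia.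
by rewrite aE; split; [apply: bounded_run_translate E brund|apply: primitive_run_translate E primd].
Qed.

(** The anchored words form a transversal [TT] of the classes: [Pseqs_anchored] reaches each class,
    [anchored_shift] makes the representative unique and, with the shift [0], the sets for different
    [d] disjoint. *)
Lemma card_Pclasses (n w : nat) :
  (3 <= n)%N -> (3 * n %/ 4 <= w)%N -> (w <= n - 1)%N ->
  #|Pclasses n w| = (\sum_(1 <= d < (n %/ 2).+1) #|anchored n w d|)%N.
Proof.
move=> n3 nw wn; have n0 : (0 < n)%N by lia.
have w0 : (0 < w)%N by lia.
pose TT := \bigcup_(i : 'I_(n %/ 2)) anchored n w i.+1.
have TTP x : reflect (exists d : nat, [/\ (0 < d)%N, (2 * d <= n)%N & x \in anchored n w d]) (x \in TT).
  apply: (iffP bigcupP) => [[i _ xi]|[[|d] [] // _ dn xd]].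
    by exists i.+1; split=> //; have := ltn_ord i; lia.
  have ltd : (d < n %/ 2)%N by lia.
  by exists (Ordinal ltd).
pose cl (x : n.-tuple bool) := [set y in Pseqs n w | `[< shift_equiv (seq_of x) (seq_of y) >]].
have TTs : {subset TT <= Pseqs n w}.
  by move=> x /TTP[d [d0 dn]]; apply: anchored_Pseqs.
have -> : Pclasses n w = cl @: TT.
  apply/setP => C; apply/imsetP/imsetP => -[x xP ->]; last by exists x; rewrite ?TTs.
  have [d [k [d0 dn yT]]] := @Pseqs_anchored n w x n3 w0 xP.
  exists (shifted x k); first by apply/TTP; exists d.
  apply/setP => y; rewrite !inE; congr (_ && _).
  apply: asbool_equiv_eq; rewrite !shift_equivP //.
  split=> -[h E].
    by exists (h - k) => z; rewrite sN_shifted // E; congr (sN x _); lia.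
  by exists (h + k) => z; rewrite E sN_shifted // addrA.
rewrite card_in_imset; last first.
  move=> x y xT yT clE.
  have [d [d0 dn xd]] := TTP x xT; have [e [e0 en ye]] := TTP y yT.
  have : y \in cl y.
    rewrite in_set (TTs y yT); apply/asboolP/shift_equivP => //.
    by exists 0 => z; rewrite addr0.
  rewrite -clE in_set => /andP[_ /asboolP/shift_equivP-/(_ n0)[k E]].
  by case: (@anchored_shift n w d e k x y).
rewrite -sum1_card partition_disjoint_bigcup => [|i j neij]; last first.
  rewrite -setI_eq0; apply/eqP/setP => x; rewrite [RHS]inE; apply/setIP => -[xi xj].
  have in2 : (2 * i.+1 <= n)%N by have := ltn_ord i; lia.
  have jn2 : (2 * j.+1 <= n)%N by have := ltn_ord j; lia.
  have E z : sN x z = sN x (z + 0) by rewrite addr0.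
  have [[ij] _] := @anchored_shift n w i.+1 j.+1 0 x x n3 nw wn (ltn0Sn _) in2 (ltn0Sn _) jn2 xi xj E.
  by rewrite (val_inj ij) eqxx in neij.
under eq_bigr => i _ do rewrite sum1_card.
by rewrite big_add1 big_mkord.
Qed.

(** * Counting the representatives *)

Lemma nth_flatten_nseq (T : Type) (x0 : T) (k : nat) (t : seq T) (i : nat) :
  (i < k * size t)%N -> nth x0 (flatten (nseq k t)) i = nth x0 t (i %% size t).
Proof.
elim: k i => [|k IHk] i //= ltik; rewrite nth_cat.
have [lti|lei] := ltnP i (size t); first by rewrite modn_small.
by rewrite IHk; [rewrite -{2}(subnK lei) modnDr|move: ltik; rewrite mulSn; lia].
Qed.

Lemma periodic_wordP (d : nat) (s : d.-tuple bool) :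
  reflect (exists e, [/\ (0 < e < d)%N, (e %| d)%N &
             forall i, (i < d)%N -> nth false s i = nth false s (i %% e)])
          (periodic_word s).
Proof.
have szs : size s = d by rewrite size_tuple.
have flatE e i : (0 < e < d)%N -> (e %| d)%N -> (i < d)%N ->
    nth false (flatten (nseq (size s %/ e) (take e s))) i = nth false s (i %% e).
  move=> ed edvd ltid; have sze : size (take e s) = e by rewrite size_takel //; lia.
  rewrite nth_flatten_nseq sze ?szs ?divnK // nth_take // ltn_mod; lia.
apply: (iffP existsP) => [[e /andP[/andP[e0 ed] /eqP sE]]|[e [ed edvd sE]]].
  have lted : (e < d)%N by rewrite -[ltnRHS]szs.
  have {}ed : (e %| d)%N by rewrite -[X in (_ %| X)%N]szs.
  exists e; split; rewrite ?e0 // => i ltid.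
  by rewrite -(@flatE e) ?e0 //; congr nth.
have lted : (e < size s)%N by rewrite szs; lia.
exists (Ordinal lted); rewrite /= szs edvd andbT; apply/andP; split; first by lia.
have dE : size (flatten (nseq (d %/ e) (take e s))) = d.
  rewrite size_flatten /shape map_nseq sumn_nseq size_takel ?szs //; last by lia.
  by rewrite mulnC divnK.
apply/eqP; apply: (@eq_from_nth _ false); rewrite ?dE ?szs // => i ltid.
by rewrite sE // -(@flatE e) // szs.
Qed.

Lemma sN_period_dvd (d e : nat) (s : d.-tuple bool) : (0 < e)%N -> (e %| d)%N ->
  (forall i, (i < d)%N -> nth false s i = nth false s (i %% e)) <->
  (forall z, sN s (z + e%:Z) = sN s z).
Proof.
move=> e0 edvd; have [dz|d0] := posnP d.
  by subst d; split=> // _ z; rewrite /sN (tuple0 s) !nth_nil.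
split=> [sE z|sE i ltid].
  have red y : exists j : nat, sN s y = nth false s j /\ exists q, y = j%:Z + q * e%:Z /\ (j < e)%N.
    have [j [ltjd [q ->]]] := @int_mod_repr d y d0.
    exists (j %% e)%N; rewrite sN_periodic_mul sN_nth // -sE //; split=> //.
    have /dvdnP[h dE] := edvd; have {}dE : h%:Z * e%:Z = d%:Z by lia.
    exists ((j %/ e)%N%:Z + q * h%:Z); split; last by rewrite ltn_mod.
    have qE : q * (h%:Z * e%:Z) = q * d%:Z by rewrite dE.
    have := divn_eq j e; lia.
  have [j [-> [q [zE lej]]]] := red z; have [j' [-> [q' [zE' lej']]]] := red (z + e%:Z).
  congr nth; have : j%:Z - j'%:Z = (q' - q - 1) * e%:Z by lia.
  have [h|[h|h]] : q' - q - 1 = 0 \/ 1 <= q' - q - 1 \/ q' - q - 1 <= -1 by lia.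
  - by rewrite h; lia.
  - have : 1 * e%:Z <= (q' - q - 1) * e%:Z by apply: ler_wpM2r; lia.
    lia.
  - have : (q' - q - 1) * e%:Z <= -1 * e%:Z by apply: ler_wpM2r; lia.
    lia.
have lei : (i %% e <= i)%N by apply: leq_mod.
rewrite -!sN_nth //; last by lia.
rewrite -[RHS](@periodic_mul (sN s) e%:Z sE (i %/ e)%N%:Z).
by congr (sN s _); have := divn_eq i e; lia.
Qed.

(** This puts aperiodicity of a word into the form of [primitive_run], in terms of its two-sided
    periodic extension. *)
Lemma AsetP (d : nat) (s : d.-tuple bool) : (0 < d)%N ->
  reflect (forall g : nat, (g %| d)%N -> (forall z, sN s (z + g%:Z) = sN s z) -> g = d)
          (s \in Aset d).
Proof.
move=> d0; rewrite inE; apply: (iffP idP) => [aper g gd sg|prim].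
  apply: contraNeq aper => gneq; apply/periodic_wordP.
  have g0 := dvdn_gt0 d0 gd; have := dvdn_leq d0 gd => gled.
  by exists g; split; rewrite ?g0 //= ?ltn_neqAle ?gneq //; apply/(@sN_period_dvd d).
apply/negP => /periodic_wordP[e [/andP[e0 ed] edvd /(sN_period_dvd _ _ _ e0 edvd) sE]].
by move: ed; rewrite (prim e edvd sE) ltnn.
Qed.

(* [s] spells one period of the run of [x], read at its own positions mod [d]. *)
Definition spells (n w d : nat) (x : n.-tuple bool) (s : d.-tuple bool) : Prop :=
  forall z, n%:Z - w%:Z - d%:Z <= z < n%:Z - 1 -> sN x z = sN s z.

(** The window has [w - 1 + d >= d] places, so its periods dividing [d] are those of [s]. The
    differences that bound the run compare the letters just outside the window with the continuation
    of [s]. *)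
Lemma spells_anchored (n w d : nat) (x : n.-tuple bool) (s : d.-tuple bool) :
  (0 < d)%N -> (0 < w)%N -> (w < n)%N -> spells n w d x s ->
  reflect [/\ s \in Aset d, sN x (n%:Z - 1) = ~~ sN s (n%:Z - 1) &
              sN x (n%:Z - w%:Z - d%:Z - 1) = ~~ sN s (n%:Z - w%:Z - d%:Z - 1)]
          (x \in anchored n w d).
Proof.
move=> d0 w0 wn xs; set a := n%:Z - w%:Z - d%:Z.
have sd z : sN s (z + d%:Z) = sN s z := sN_periodic d s z.
have aL : a + w.-1%:Z + d%:Z = n%:Z - 1 by rewrite /a; lia.
have rund : run (sN x) d%:Z a w.-1%:Z.
  by move=> z zr; rewrite !xs ?sd; rewrite /a in zr *; lia.
have primE : primitive_run (sN x) d a w.-1%:Z <-> s \in Aset d.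
  split=> [prim|/(AsetP _ _ d0) aper g gd perg].
    apply/AsetP => // g gd sg; apply: prim => // z k zr yr.
    rewrite !xs; try by rewrite /a in zr yr; lia.
    exact: (@periodic_mul (sN s) g%:Z sg).
  apply: aper => // z.
  pose b := Num.min a z; pose K : int := `|a - z| + n%:Z + d%:Z + g%:Z + 1.
  have perd y L : period_on (sN s) d%:Z y L.
    by move=> u k _ _; apply: (@periodic_mul (sN s) d%:Z).
  have perga : period_on (sN s) g%:Z a (w.-1%:Z + d%:Z).
    by move=> y k yr y'r; rewrite -!xs; [exact: perg|rewrite /a in yr y'r; lia..].
  have perK : period_on (sN s) g%:Z b K.
    by apply: (@period_on_refine (sN s) d%:Z g%:Z b a K (w.-1%:Z + d%:Z)) => //; rewrite /K /b; lia.
  by have := perK z 1; rewrite mul1r; apply; rewrite /K /b; lia.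
have d1E : dif (sN x) d%:Z (a - 1) = (sN x (a - 1) != sN s (a - 1)).
  rewrite /dif (xs (a - 1 + d%:Z)) ?sd; last by rewrite /a; lia.
  by case: sN; case: sN.
have d2E : dif (sN x) d%:Z (a + w.-1%:Z) = (sN x (n%:Z - 1) != sN s (n%:Z - 1)).
  rewrite /dif aL (xs (a + w.-1%:Z)); last by rewrite /a; lia.
  by rewrite -sd aL; case: sN; case: sN.
have neqE b1 b2 : (b1 != b2) = (b1 == ~~ b2) :> bool by case: b1; case: b2.
rewrite [x \in anchored _ _ _]in_set; apply: (iffP (asboolP _)) => [[[_ d1 d2] /primE sA]|[sA E2 E1]].
  by split=> //; apply/eqP; rewrite -neqE -?d2E -?d1E.
split; last exact/primE.
by split=> //; rewrite ?d1E ?d2E neqE ?E1 ?E2.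
Qed.

Lemma anchored_spells (n w d : nat) (x : n.-tuple bool) :
  (0 < d)%N -> (0 < w)%N -> (w < n)%N ->
  x \in anchored n w d -> exists s, spells n w d x s.
Proof.
move=> d0 w0 wn; rewrite inE => /asboolP[[rund _ _] _].
set a := n%:Z - w%:Z - d%:Z in rund *.
have perd : period_on (sN x) d%:Z a (w.-1%:Z + d%:Z) by apply: period_on_step => //; lia.
(* Letter [i] is read at the place among the first [d] of the window that is congruent to [i] modulo
   [d]. *)
exists [tuple sN x (a + (((i : nat)%:Z - a) %% d%:Z)%Z) | i < d] => z zr.
have [i [ltid [q zE]]] := @int_mod_repr d z d0.
rewrite zE sN_periodic_mul sN_nth // -[i in RHS]/(val (Ordinal ltid)) -tnth_nth tnth_mktuple /=.
pose h := ((i%:Z - a) %/ d%:Z)%Z; pose r := ((i%:Z - a) %% d%:Z)%Z.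
have hE := divz_eq (i%:Z - a) d%:Z; rewrite -/h -/r in hE *.
have r0 : 0 <= r by apply: modz_ge0; lia.
have rd : r < d%:Z by have := @ltz_pmod (i%:Z - a) d%:Z; rewrite -/r; lia.
have -> : i%:Z + q * d%:Z = a + r + (h + q) * d%:Z by lia.
apply: perd; first lia.
have -> : a + r + (h + q) * d%:Z = z by lia.
by rewrite /a in zr *; lia.
Qed.

Lemma sN_mktuple (n : nat) (f : nat -> bool) (i : nat) :
  (i < n)%N -> sN [tuple f i | i < n] i%:Z = f i.
Proof.
by move=> ltin; rewrite sN_nth // -[i in LHS]/(val (Ordinal ltin)) -tnth_nth tnth_mktuple.
Qed.

Lemma eq_tuple_window (d : nat) (s t : d.-tuple bool) (a : int) : (0 < d)%N ->
  (forall z, a <= z < a + d%:Z -> sN s z = sN t z) -> s = t.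
Proof.
move=> d0 E; apply: sN_inj => z.
have := divz_eq (z - a) d%:Z; set q := ((z - a) %/ d%:Z)%Z; set r := ((z - a) %% d%:Z)%Z => zE.
have r0 : 0 <= r by apply: modz_ge0; lia.
have rd : r < d%:Z by have := @ltz_pmod (z - a) d%:Z; rewrite -/r; lia.
have -> : z = a + r + q * d%:Z by lia.
by rewrite !sN_periodic_mul E //; lia.
Qed.

(** The window and its two neighbours fit into one period. The left neighbour sits at [k], so [k]
    also counts the free letters before it. *)
Lemma card_anchored_small (n w d : nat) :
  (0 < d)%N -> (0 < w)%N -> (d + w < n)%N -> (2 * d <= n)%N ->
  (#|anchored n w d| = #|Aset d| * 2 ^ (n - w - 1 - d))%N.
Proof.
move=> d0 w0 dwn dn; set k := (n - w - 1 - d)%N.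
have wn : (w < n)%N by lia.
pose word (p : d.-tuple bool * k.-tuple bool) (i : nat) :=
  if (i < k)%N then nth false p.2 i
  else if (i == k) || (i == n.-1) then ~~ sN p.1 i%:Z else sN p.1 i%:Z.
pose mk p : n.-tuple bool := [tuple word p i | i < n].
have mkE p (i : nat) : (i < n)%N -> sN (mk p) i%:Z = word p i by apply: sN_mktuple.
have mks p : spells n w d (mk p) p.1.
  move=> z zr; have zE : z = `|z|%N%:Z by lia.
  rewrite zE mkE /word; last by lia.
  have -> : (`|z| < k)%N = false by rewrite /k; lia.
  by have -> : (`|z|%N == k) || (`|z|%N == n.-1) = false by rewrite /k; lia.
have -> : anchored n w d = mk @: setX (Aset d) setT.
  apply/setP => x; apply/idP/imsetP => [xa|[p]]; last first.
    case: p => s f /setXP[pA _] ->; apply/(@spells_anchored n w d _ _ d0 w0 wn (mks (s, f))).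
    have -> : n%:Z - 1 = n.-1%:Z by lia.
    have -> : n%:Z - w%:Z - d%:Z - 1 = k%:Z by rewrite /k; lia.
    rewrite !mkE /word ?ltnn ?eqxx ?orbT ?if_same /k; try lia.
    by split=> //; case: ltnP => //; lia.
  have [s xs] := @anchored_spells n w d x d0 w0 wn xa.
  have /(@spells_anchored n w d _ _ d0 w0 wn xs)[sA x1 xk] := xa.
  exists (s, [tuple nth false x i | i < k]); first by rewrite in_setX /= sA in_setT.
  apply: sN_inj => z; have [i [ltin [q ->]]] := @int_mod_repr n z ltac:(lia).
  rewrite !sN_periodic_mul mkE // /word.
  have [ltik|leki] := ltnP i k.
    by rewrite -(@sN_nth k _ i ltik) [RHS](@sN_mktuple k (nth false x)) ?sN_nth.
  have [->|ik] := eqVneq i k.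
    have -> : k%:Z = n%:Z - w%:Z - d%:Z - 1 by rewrite /k; lia.
    exact: xk.
  have [->|in1] := eqVneq i n.-1.
    have -> : n.-1%:Z = n%:Z - 1 by lia.
    exact: x1.
  by apply: xs; rewrite /k in leki ik; lia.
rewrite card_in_imset ?cardsX ?cardsT ?card_tuple ?card_bool //.
move=> [s f] [t g] _ _ E; congr pair.
  apply: (@eq_tuple_window d _ _ (n%:Z - w%:Z - d%:Z)) => // z zr.
  by rewrite -(mks (s, f)) ?E ?(mks (t, g)) //; lia.
apply: val_inj; apply: (@eq_from_nth _ false); rewrite !size_tuple // => i ltik.
have : sN (mk (s, f)) i%:Z = sN (mk (t, g)) i%:Z by rewrite E.
have ltin : (i < n)%N by rewrite /k in ltik; lia.
by rewrite !mkE // /word ltik.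
Qed.

(** The window starts at [- t], with [t = w + d - n], and its negative places are read again as
    [n - i]. Place [-1] is the complemented last letter, places [- i] for [2 <= i <= t] must agree
    with [s], and the left neighbour [- t - 1] must not. For [t = 0] that neighbour is the last
    letter itself, whence the separate clause of [Nset]. *)
Lemma NsetP (n w d : nat) (s : d.-tuple bool) (x : n.-tuple bool) :
  (0 < d)%N -> (w < n)%N -> (n <= w + d)%N -> (d < n)%N ->
  sN x (n%:Z - 1) = ~~ sN s (n%:Z - 1) ->
  (forall i : nat, (i < n.-1)%N -> sN x i%:Z = sN s i%:Z) ->
  reflect [/\ s \in Aset d, spells n w d x s &
             sN x (n%:Z - w%:Z - d%:Z - 1) = ~~ sN s (n%:Z - w%:Z - d%:Z - 1)]
          (s \in Nset n d (w + d - n)).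
Proof.
move=> d0 wn nwd dn x1 x0; set t := (w + d - n)%N.
have sd z : sN s (d%:Z + z) = sN s z by rewrite addrC sN_periodic.
have xn z : sN x (n%:Z + z) = sN x z by rewrite addrC sN_periodic.
have xneg (i : nat) : (1 < i <= n)%N -> sN x (- i%:Z) = sN s (n%:Z - i%:Z).
  move=> ir; rewrite -xn; have -> : n%:Z - i%:Z = (n - i)%N%:Z by lia.
  by apply: x0; lia.
have -> : n%:Z - w%:Z - d%:Z - 1 = - t.+1%:Z by rewrite /t; lia.
have x1' : sN x (- 1) = ~~ sN s (n%:Z - 1) by rewrite -xn.
rewrite [s \in Nset _ _ _]in_set; apply: (iffP andP) => [[sA cond]|[sA xs xt]]; split=> //.
- move=> z zr; have [z0|z0] := lerP 0 z.
    by rewrite -(gez0_abs z0); apply: x0; lia.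
  have t0 : (t == 0%N) = false by rewrite /t; lia.
  move: cond; rewrite t0 => /and3P[/eqP c1 /forallP c2 _].
  have [->|zn1] := eqVneq z (-1); first by rewrite x1' c1 sd.
  pose i := `|z|%N; have zE : z = - i%:Z by rewrite /i; lia.
  rewrite zE xneg; last by rewrite /i; lia.
  have it : (i < t.+1)%N by rewrite /i /t; lia.
  have /implyP := c2 (Ordinal it) => /(_ _)/eqP/=.
  by rewrite sd => ->//; rewrite /i; lia.
- have [t0|t0] := posnP t.
    by move: cond; rewrite t0 /= sd x1' => /eqP ->.
  have tn0 : (t == 0%N) = false by lia.
  move: cond; rewrite tn0 xneg; last by rewrite /t; lia.
  move=> /and3P[_ _ /eqP]; have -> : n%:Z - t%:Z - 1 = n%:Z - t.+1%:Z by lia.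
  by move=> ->; rewrite -addrA sd; congr (~~ sN s _); lia.
have [t0|t0] := posnP t.
  by move: xt; rewrite t0 x1' sd => /(canLR negbK)/esym; rewrite negbK => ->.
apply/and3P; split.
- by rewrite sd -x1'; apply/eqP; apply: xs; rewrite /t in t0; lia.
- apply/forallP => -[i lti] /=; apply/implyP => i2; have lti' : (i < (w + d - n).+1)%N by [].
  by rewrite sd -xneg; [apply/eqP; apply: xs; lia|lia].
- have -> : n%:Z - t%:Z - 1 = n%:Z - t.+1%:Z by lia.
  rewrite -xneg; last by rewrite /t; lia.
  by rewrite xt -addrA sd; apply/eqP; congr (~~ sN s _); lia.
Qed.

(** Here [s] determines the word: it is copied up to place [n - 2] and complemented at [n - 1].
    Since [d <= n - 1], the copied part gives [s] back. *)
Lemma card_anchored_large (n w d : nat) :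
  (0 < d)%N -> (0 < w)%N -> (w < n)%N -> (n <= d + w)%N -> (d < n)%N ->
  #|anchored n w d| = #|Nset n d (w + d - n)|.
Proof.
move=> d0 w0 wn nwd dn.
pose word (s : d.-tuple bool) (i : nat) := if i == n.-1 then ~~ sN s i%:Z else sN s i%:Z.
pose mk s : n.-tuple bool := [tuple word s i | i < n].
have mkE s (i : nat) : (i < n)%N -> sN (mk s) i%:Z = word s i by apply: sN_mktuple.
have mk1 s : sN (mk s) (n%:Z - 1) = ~~ sN s (n%:Z - 1).
  have -> : n%:Z - 1 = n.-1%:Z by lia.
  by rewrite mkE /word ?eqxx //; lia.
have mk0 s (i : nat) : (i < n.-1)%N -> sN (mk s) i%:Z = sN s i%:Z.
  move=> lti; rewrite mkE /word; last by lia.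
  by have -> : (i == n.-1) = false by lia.
have nwd' : (n <= w + d)%N by lia.
have -> : anchored n w d = mk @: Nset n d (w + d - n).
  apply/setP => x; apply/idP/imsetP => [xa|[s sN ->]]; last first.
    have /(@NsetP n w d s (mk s) d0 wn nwd' dn (mk1 s) (mk0 s))[sA xs xk] := sN.
    by apply/(@spells_anchored n w d _ _ d0 w0 wn xs).
  have [s xs] := @anchored_spells n w d x d0 w0 wn xa.
  have /(@spells_anchored n w d _ _ d0 w0 wn xs)[sA x1 xk] := xa.
  have x0 (i : nat) : (i < n.-1)%N -> sN x i%:Z = sN s i%:Z.
    by move=> lti; apply: xs; lia.
  exists s; first by apply/(@NsetP n w d s x d0 wn nwd' dn x1 x0).
  apply: sN_inj => z; have [i [ltin [q ->]]] := @int_mod_repr n z ltac:(lia).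
  rewrite !sN_periodic_mul mkE // /word.
  have [/eqP ->|in1] := ifP; last by apply: x0; lia.
  have -> : n.-1%:Z = n%:Z - 1 by lia.
  exact: x1.
rewrite card_in_imset // => s t _ _ E.
apply: (@eq_tuple_window d _ _ 0) => // z zr; have -> : z = `|z|%N%:Z by lia.
by rewrite -(mk0 s) ?E ?mk0 //; lia.
Qed.

(** * Möbius inversion and the number of aperiodic words *)

Lemma moebius_prime_mul (p f : nat) : prime p -> (0 < f)%N ->
  moebius (p * f) = if (p %| f)%N then 0 else - moebius f.
Proof.
move=> p_pr f0; have p0 := prime_gt0 p_pr.
have pf0 : (p * f == 0)%N = false by rewrite muln_eq0; lia.
have nf0 : (f == 0)%N = false by lia.
rewrite /moebius pf0 nf0; have [pf|npf] := ifPn (p %| f)%N.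
  case: ifP => // /allP/(_ p); rewrite mem_primes p_pr muln_gt0 p0 f0 dvdn_mulr // => /(_ isT).
  rewrite lognM // logn_prime // eqxx.
  have : (0 < logn p f)%N by rewrite logn_gt0 mem_primes p_pr f0.
  by lia.
have prE : perm_eq (primes (p * f)) (p :: primes f).
  apply: uniq_perm; rewrite ?primes_uniq //=.
    by rewrite primes_uniq andbT mem_primes (negPf npf) !andbF.
  by move=> q; rewrite primesM // primes_prime // !inE.
rewrite (perm_size prE) /= exprS mulN1r.
have -> : squarefree (p * f) = squarefree f.
  rewrite /squarefree (perm_all _ prE) /=.
  have -> : logn p (p * f) == 1%N.
    rewrite lognM // logn_prime // eqxx.
    by rewrite (_ : logn p f = 0%N) //; apply/eqP; rewrite -leqn0 leqNgt logn_gt0 mem_primes (negPf npf) !andbF.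
  apply: eq_in_all => q; rewrite mem_primes => /and3P[q_pr _ qf].
  rewrite lognM // logn_prime //; case: (q =P p) => // qp.
  by rewrite -qp qf in npf.
by case: ifP; rewrite // oppr0.
Qed.

(** For a prime [p] dividing [k], the divisors [p * f] with [f] prime to [p] cancel the divisors
    [f], and those with [p] dividing [f] contribute [0]. *)
Lemma sum_moebius (k : nat) : (0 < k)%N ->
  \sum_(e <- divisors k) moebius e = (k == 1%N)%:R.
Proof.
move=> k0; have [->|k1] := eqVneq k 1%N; first by rewrite big_seq1.
have [p p_pr pk] : exists2 p, prime p & (p %| k)%N.
  by exists (pdiv k); rewrite ?pdiv_dvd ?pdiv_prime //; lia.
have p0 := prime_gt0 p_pr.
have kp0 : (0 < k %/ p)%N by rewrite divn_gt0 // dvdn_leq.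
rewrite (bigID (fun e => p %| e)%N) /=.
have -> : \sum_(e <- divisors k | (p %| e)%N) moebius e =
          \sum_(f <- divisors (k %/ p)) moebius (p * f).
  rewrite -big_filter -(big_map (muln p) xpredT moebius); apply: perm_big.
  have injp : injective (muln p) by move=> a b /eqP; rewrite eqn_pmul2l // => /eqP.
  apply: uniq_perm; rewrite ?filter_uniq ?(map_inj_uniq injp) ?divisors_uniq // => e.
  rewrite mem_filter -dvdn_divisors //; apply/andP/mapP => [[pe ek]|[f]].
    exists (e %/ p)%N; last by rewrite mulnC divnK.
    rewrite -dvdn_divisors //.
    by rewrite -(@dvdn_pmul2r p) // !divnK.
  rewrite -dvdn_divisors // => fk ->.
  by rewrite dvdn_mulr // mulnC -(divnK pk) dvdn_pmul2r.
rewrite (eq_big_seq (fun f => if ~~ (p %| f)%N then - moebius f else 0)); last first.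
  move=> f; rewrite -dvdn_divisors // => fk.
  rewrite moebius_prime_mul //; first by case: ifP.
  by exact: dvdn_gt0 fk.
rewrite -big_mkcond sumrN; apply/eqP; rewrite addrC subr_eq0.
rewrite -big_filter -[X in _ == X]big_filter; apply/eqP/perm_big/uniq_perm.
- by rewrite filter_uniq ?divisors_uniq.
- by rewrite filter_uniq ?divisors_uniq.
move=> f; rewrite !mem_filter; have [//|npf /=] := boolP (p %| f)%N.
rewrite -!dvdn_divisors //.
by rewrite -{1}(divnK pk) Gauss_dvdl // coprime_sym prime_coprime.
Qed.

(** Both sums run over the pairs with [e * f] dividing [d]; summing over [e] first leaves only
    [f = d]. *)
Lemma moebius_inversion (F G : nat -> int) (d : nat) : (0 < d)%N ->
  (forall k, (0 < k)%N -> G k = \sum_(f <- divisors k) F f) ->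
  F d = \sum_(e <- divisors d) moebius e * G (d %/ e)%N.
Proof.
move=> d0 GF.
have dvd_quot e f : (0 < e)%N -> (e %| d)%N -> (f %| d %/ e)%N = (e * f %| d)%N.
  by move=> e0 ed; rewrite -{2}(divnK ed) mulnC dvdn_pmul2r.
have inner e : e \in divisors d -> moebius e * G (d %/ e)%N =
    \sum_(f <- divisors d | (e * f %| d)%N) moebius e * F f.
  rewrite -dvdn_divisors // => ed; have e0 := dvdn_gt0 d0 ed.
  have de0 : (0 < d %/ e)%N by rewrite divn_gt0 // dvdn_leq.
  rewrite GF // -mulr_sumr; congr (_ * _); rewrite -[RHS]big_filter.
  apply/perm_big/uniq_perm; rewrite ?filter_uniq ?divisors_uniq // => f.
  rewrite mem_filter -!dvdn_divisors // dvd_quot //.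
  by apply/idP/andP => [efd|[]//]; split=> //; apply: dvdn_trans efd; apply: dvdn_mull.
rewrite (eq_big_seq _ inner) (exchange_big_dep xpredT) //=.
have inner' f : f \in divisors d ->
    \sum_(e <- divisors d | (e * f %| d)%N) moebius e * F f = (f == d)%:R * F f.
  rewrite -dvdn_divisors // => fd; have f0 := dvdn_gt0 d0 fd.
  have df0 : (0 < d %/ f)%N by rewrite divn_gt0 // dvdn_leq.
  have -> : (f == d) = (d %/ f == 1)%N.
    by rewrite [RHS]eq_sym eqn_div // mul1n.
  rewrite -mulr_suml -sum_moebius //; congr (_ * _); rewrite -[LHS]big_filter.
  apply/perm_big/uniq_perm; rewrite ?filter_uniq ?divisors_uniq // => e.
  rewrite mem_filter -!dvdn_divisors // dvd_quot // mulnC.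
  by apply/andP/idP => [[]//|fed]; split=> //; apply: dvdn_trans fed; apply: dvdn_mull.
rewrite (eq_big_seq _ inner') (bigD1_seq d) ?divisors_uniq ?divisors_id //=.
by rewrite eqxx mul1r big1 ?addr0 // => f /negPf ->; rewrite mul0r.
Qed.

Lemma gcdn_period (U : int -> bool) (e f : nat) : (0 < e)%N -> (0 < f)%N ->
  (forall z, U (z + e%:Z) = U z) -> (forall z, U (z + f%:Z) = U z) ->
  forall z, U (z + (gcdn e f)%:Z) = U z.
Proof.
move=> e0 f0 Ue Uf z.
have per p L : (forall y, U (y + p) = U y) -> period_on U p z L.
  by move=> Up y k _ _; apply: (@periodic_mul U p).
have ge : (gcdn e f <= e)%N by apply: dvdn_leq => //; apply: dvdn_gcdl.
have : period_on U (gcdn e f)%:Z z (e%:Z + f%:Z).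
  by apply: fine_wilf => //; [rewrite gerBl|exact: per|exact: per].
move: (gcdn e f) ge => g ge /(_ z 1); rewrite mul1r; apply; lia.
Qed.

(** Each word is a power of a unique aperiodic word, whose length is the least divisor of [d] that
    is a period. Uniqueness holds because the gcd of two periods is a period. *)
Lemma card_words (d : nat) : (0 < d)%N ->
  (2 ^ d = \sum_(e <- divisors d) #|Aset e|)%N.
Proof.
move=> d0.
pose W e : {set d.-tuple bool} :=
  [set x | `[< exists2 s : e.-tuple bool, s \in Aset e & forall z, sN x z = sN s z >]].
pose mk e (s : e.-tuple bool) : d.-tuple bool := [tuple sN s (i : nat)%:Z | i < d].
have mkE e s z : (e %| d)%N -> sN (mk e s) z = sN s z.
  move=> /dvdnP[h dE]; have [i [ltid [q ->]]] := @int_mod_repr d z d0.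
  rewrite sN_periodic_mul (@sN_mktuple d (fun i => sN s i%:Z)) //.
  rewrite (_ : q * d%:Z = q * h%:Z * e%:Z) ?sN_periodic_mul //.
  by rewrite -mulrA -PoszM -dE.
have cardW e : (e %| d)%N -> #|W e| = #|Aset e|.
  move=> ed; rewrite -(card_in_imset (f := mk e)); last first.
    by move=> s t _ _ E; apply: sN_inj => z; rewrite -(mkE e s) // E mkE.
  apply: eq_card => x; rewrite in_set; apply/asboolP/imsetP => [[s sA xs]|[s sA ->]].
    by exists s => //; apply: sN_inj => z; rewrite mkE.
  by exists s => // z; rewrite mkE.
pose F (i : 'I_d) := if (i.+1 %| d)%N then W i.+1 else set0.
have cover : \bigcup_i F i = setT.
  apply/setP => x; rewrite in_setT; apply/bigcupP.
  pose P e := [&& (0 < e)%N, (e %| d)%N & `[< forall z, sN x (z + e%:Z) = sN x z >]].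
  have exP : exists e, P e.
    by exists d; rewrite /P d0 dvdnn; apply/asboolP => z; exact: sN_periodic.
  case: (ex_minnP exP) => -[|e] /and3P[// _ ed /asboolP xe] mine.
  have lted : (e < d)%N by apply: dvdn_leq.
  exists (Ordinal lted) => //; rewrite /F /= ed in_set; apply/asboolP.
  pose s : e.+1.-tuple bool := [tuple sN x (i : nat)%:Z | i < e.+1].
  have xs z : sN x z = sN s z.
    have [i [ltie [q ->]]] := @int_mod_repr e.+1 z isT.
    rewrite sN_periodic_mul (@sN_mktuple e.+1 (fun i => sN x i%:Z)) //.
    by rewrite (@periodic_mul (sN x) e.+1%:Z xe).
  exists s => //; apply/AsetP => // g ge sg.
  apply/eqP; rewrite eqn_leq dvdn_leq //=; apply: mine; rewrite /P (dvdn_gt0 _ ge) //=.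
  by rewrite (dvdn_trans ge) //; apply/asboolP => z; rewrite !xs.
have disj i j : i != j -> [disjoint F i & F j].
  apply: contraNT => /pred0Pn[x /andP[]] /=; rewrite /F.
  case: ifP => [id|_]; last by rewrite in_set0.
  case: ifP => [jd|_]; last by rewrite in_set0.
  rewrite !in_set => /asboolP[s /AsetP sA xs] /asboolP[t /AsetP tA xt].
  have perg z : sN x (z + (gcdn i.+1 j.+1)%:Z) = sN x z.
    by apply: (@gcdn_period (sN x)) => // y; [rewrite !xs|rewrite !xt]; rewrite sN_periodic.
  have gi : gcdn i.+1 j.+1 = i.+1.
    by apply: sA => // [|z]; [exact: dvdn_gcdl|rewrite -!xs].
  have gj : gcdn i.+1 j.+1 = j.+1.
    by apply: tA => // [|z]; [exact: dvdn_gcdr|rewrite -!xt].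
  by apply/eqP/val_inj; apply: succn_inj; rewrite -gi gj.
have -> : (2 ^ d = #|[set: d.-tuple bool]|)%N by rewrite cardsT card_tuple card_bool.
rewrite -cover -sum1_card partition_disjoint_bigcup //.
under eq_bigr => i _ do rewrite sum1_card.
transitivity (\sum_(1 <= e < d.+1 | (e %| d)%N) #|Aset e|)%N.
  rewrite big_add1 /= big_mkord [RHS]big_mkcond; apply: eq_bigr => i _.
  by rewrite /F; case: ifP => [/cardW|_] //; rewrite cards0.
rewrite -big_filter; apply/perm_big/uniq_perm; rewrite ?filter_uniq ?divisors_uniq ?iota_uniq // => e.
rewrite mem_filter mem_index_iota -dvdn_divisors //; apply: andb_idr => ed.
by rewrite (dvdn_gt0 d0 ed) ltnS dvdn_leq.
Qed.

Lemma card_Aset (d : nat) : (0 < d)%N ->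
  (#|Aset d|%:Z : int) = \sum_(e <- divisors d) moebius e * (2 ^ (d %/ e))%N%:Z.
Proof.
move=> d0; apply: (@moebius_inversion (fun k => #|Aset k|%:Z) (fun k => (2 ^ k)%N%:Z)) => //.
move=> k k0; rewrite card_words // -natz natr_sum.
by apply: eq_bigr => e _; rewrite natz.
Qed.

Theorem theorem3 (n w : nat) :
  (3 <= n)%N -> (3 * n %/ 4 <= w)%N -> (w <= n - 1)%N ->
  (#|Pclasses n w|%:Z : int) =
    \sum_(1 <= d < n - w) \sum_(e <- divisors d)
        moebius e * (2 ^ (n - w - 1 - d + d %/ e))%N%:Z
    + \sum_(n - w <= d < (n %/ 2).+1) (#|Nset n d (w + d - n)|)%:Z.
Proof.
move=> n3 nw wn; rewrite card_Pclasses //.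
have w0 : (0 < w)%N by lia.
(* From [d = n - w] on, the window with both its neighbours exceeds one period, which separates the
   two counts. *)
rewrite (@big_cat_nat _ _ _ (n - w)%N) /=; [|lia..].
rewrite PoszD -!natz !natr_sum; congr (_ + _); apply: eq_big_nat => d dr.
  rewrite natz card_anchored_small; [|lia..].
  rewrite PoszM card_Aset; last by lia.
  rewrite mulr_suml; apply: eq_bigr => e _.
  by rewrite -mulrA -PoszM -expnD addnC.
by rewrite !natz card_anchored_large //; lia.
Qed.
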